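(* For every nonnegative integer $n$ there exist nonnegative integers $x,y,z,w$ such that $$n=p_5(x)+p_5(y)+p_5(z)+2p_5(w).$$ Equivalently, every nonnegative integer is a sum of five pentagonal numbers two of which are equal.
   Context: For $k\in\mathbb{Z}$, $p_5(k)=k(3k-1)/2$. The pentagonal numbers are the values $p_5(k)$ with $k\in\{0,1,2,\ldots\}$. *)

(* Defs.v *)
From mathcomp Require Import all_boot.
(* Pentagonal numbers: p5 k = k(3k-1)/2 for k in {0,1,2,...}.
   For k : nat, k*(3k-1) is even, so the nat division is exact;
   for k = 0 the truncated subtraction gives 0*0 = 0 = p5(0). *)
Definition p5 (k : nat) : nat := (k * (3 * k - 1)) %/ 2.

(* Main.v *)
(** Put N = 24 n + 5.  Since 24 p5(x) + 1 = (6 x - 1)^2, we need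
    N = X^2 + Y^2 + Z^2 + 2 W^2 with X, Y, Z, W positive and congruent to -1 mod 6.

    Three odd squares.  For M = 3 mod 8 the number t(M) of solutions of
    x^2 + y^2 + z^2 = M and the number c(M) of solutions of ab + bc + ca = M in
    positive odd integers coincide; as c(M) counts (1, 1, (M - 1) / 2), M is a sum
    of three odd squares.  Indeed both F = t and F = c satisfy F(3) = 1 and
    sum_w (P - 4 w^2) F(P - w^2) = 0 over odd w > 0, for every P = 4 m with m odd.
    For t this is the symmetry of x^2 + y^2 + z^2 + w^2.  For c it says that
    (a + w)(b - w) sums to 0 over ab + bc + ca + w^2 = 4 m.  In the coordinates
    X = (a + w) / 2, Y = (b + c) / 2, Z = (b - w) / 2, T = (c - w) / 2 the equation is
    XY + ZT = m and the weight is 4 X Z; for fixed X > Z > 0 the solutions form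
    chains with step (Y, T) -> (Y + 2 Z, T - 2 X), the terms with Z > 0 amount to the
    first elements of the chains in a quadrant, and those with Z < 0 to the last ones.

    Large n.  The isometry of x^2 + y^2 + z^2 + 2 w^2 over Q that maps the last axis
    to (7, 4, 1, 4) / 7 turns N = A^2 + B^2 + C^2 + 2 h^2 into a representation by
    X, Y, Z, W, positive as soon as 196 h^2 > 97 N, because 7X + 4Y + Z + 8W = 14 h.
    It is integral with all coordinates -1 mod 6 if h = -1 mod 6, A = B = C = 3 mod 6,
    B + C = 0 mod 4 and B = h + 3 A mod 7.  Choosing h mod 126 suitably, N - 2 h^2 is
    9 times a number that is 3 mod 8, and the condition mod 7 can be met by permuting
    A, B, C and changing signs.

    Small n.  Every R with 3794 <= R < 21217 has the form p5(y) + p5(z) + 2 p5(w), and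
    subtracting from n the largest p5(x) <= n - 3794 leads to this range. *)

From Stdlib Require Import ZArith List FMapPositive.
Require Import Defs.
From mathcomp Require Import all_boot all_order all_algebra zify ring.
Set Implicit Arguments. Unset Strict Implicit. Unset Printing Implicit Defensive.
Import GRing.Theory Num.Theory.

(** * Three odd squares *)

Section ThreeOddSquares.
Local Open Scope ring_scope.
Local Notation int4 := (int * int * int * int)%type.

(** * Reindexing finite sums over boxes *)

Lemma sum_bij (T U : eqType) (s : seq T) (r : seq U) (P : pred T) (Q : pred U)
    (f : T -> U) (g : U -> T) (F : T -> int) (G : U -> int) :
  uniq s -> uniq r ->
  (forall x, x \in s -> P x -> [/\ f x \in r, Q (f x), g (f x) = x & F x = G (f x)]) ->
  (forall y, y \in r -> Q y -> [/\ g y \in s, P (g y) & f (g y) = y]) ->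
  \sum_(x <- s | P x) F x = \sum_(y <- r | Q y) G y.
Proof.
move=> us ur hf hg; rewrite -big_filter -[RHS]big_filter.
have -> : \sum_(x <- [seq x <- s | P x]) F x =
          \sum_(y <- [seq f x | x <- [seq x <- s | P x]]) G y.
  rewrite big_map; apply: eq_big_seq => x.
  by rewrite mem_filter => /andP[Px xs]; case: (hf x xs Px).
apply: perm_big; apply: uniq_perm.
- rewrite map_inj_in_uniq ?filter_uniq // => x y.
  rewrite !mem_filter => /andP[Px xs] /andP[Py ys] e.
  case: (hf x xs Px) => _ _ <- _; rewrite e.
  by case: (hf y ys Py).
- exact: filter_uniq.
move=> y; rewrite mem_filter; apply/mapP/andP => [[x]|[Qy yr]].
  by rewrite mem_filter => /andP[Px xs] ->; case: (hf x xs Px).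
case: (hg y yr Qy) => gs Pg e; exists (g y) => //.
by rewrite mem_filter Pg.
Qed.

Definition zrange (K : nat) : seq int := [seq i%:Z - K%:Z | i <- iota 0 K.*2.+1].

Lemma mem_zrange K x : (x \in zrange K) = (- K%:Z <= x <= K%:Z).
Proof.
apply/mapP/idP => [[i]|h]; first by rewrite mem_iota => hi ->; lia.
by exists (absz (x + K%:Z)); [rewrite mem_iota; lia | lia].
Qed.

Lemma zrange_uniq K : uniq (zrange K).
Proof. by rewrite map_inj_uniq ?iota_uniq // => i j; lia. Qed.

(** Solution sets are cut out of a box by a predicate. The [_box] lemmas show that a large box
    truncates nothing, so bijections between solution sets need only respect the predicates. *)
Definition zbox (K : nat) : seq int4 :=
  [seq (p, w) | p <- [seq (q, c) | q <- [seq (a, b) | a <- zrange K, b <- zrange K],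
                                   c <- zrange K], w <- zrange K].

Lemma mem_pairs (T U : eqType) (s : seq T) (r : seq U) x y :
  ((x, y) \in [seq (a, b) | a <- s, b <- r]) = (x \in s) && (y \in r).
Proof.
apply/allpairsP/andP => [[[a b] /= [? ? [-> ->]]]//|[xs yr]].
by exists (x, y).
Qed.

Lemma pairs_uniq (T U : eqType) (s : seq T) (r : seq U) :
  uniq s -> uniq r -> uniq [seq (a, b) | a <- s, b <- r].
Proof. by move=> us ur; apply: allpairs_uniq => // -[a b] [c d] _ _. Qed.

Lemma mem_zbox K a b c w :
  ((a, b, c, w) \in zbox K) =
  [&& - K%:Z <= a <= K%:Z, - K%:Z <= b <= K%:Z, - K%:Z <= c <= K%:Z & - K%:Z <= w <= K%:Z].
Proof. by rewrite !mem_pairs !mem_zrange -!andbA. Qed.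

Lemma zbox_uniq K : uniq (zbox K).
Proof. by rewrite !pairs_uniq ?zrange_uniq. Qed.

(** * The weighted sum over XY + ZT = m *)

Definition odd_pos (x : int) := (0 < x) && ((x %% 2)%Z == 1).

(** In the change of variables a, b, c, w are all congruent to Y + Z + T mod 2, so the parity
    condition makes them odd. *)
Definition quad (m : int) (v : int4) : bool :=
  let: (X, Y, Z, T) := v in (X * Y + Z * T == m) && (((Y + Z + T) %% 2)%Z == 1).

Definition wt (v : int4) : int := let: (X, Y, Z, T) := v in X * Z.

(* The four inequalities say that w = Y - Z - T, b = Y + Z - T, a = 2X - Y + Z + T
   and c = Y - Z + T are positive. *)
Definition chamber m (v : int4) : bool :=
  let: (X, Y, Z, T) := v in
  [&& quad m v, Z < Y - T, - Z < Y - T, Y - T < 2 * X + Z & Z < Y + T].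

Definition quadrant m (v : int4) : bool :=
  let: (X, Y, Z, T) := v in
  [&& quad m v, 0 < Z, Z < X, - Z < Y - T & Z < Y + T].

Lemma le_mul_pos (a b : int) : 0 < a -> 0 < b -> a <= a * b.
Proof. by move=> *; nia. Qed.

Lemma chamber_box m K X Y Z T : 4 * m <= K%:Z -> chamber m (X, Y, Z, T) -> (X, Y, Z, T) \in zbox K.
Proof.
move=> hK; rewrite /chamber /quad mem_zbox => /and5P[/andP[/eqP e _] h1 h2 h3 h4].
set a := 2 * X - Y + Z + T; set b := Y + Z - T; set c := Y - Z + T; set w := Y - Z - T.
have e' : a * b + b * c + c * a + w * w = 4 * m by rewrite -e /a /b /c /w; ring.
have ha : 0 < a by rewrite /a; lia.
have hb : 0 < b by rewrite /b; lia.
have hc : 0 < c by rewrite /c; lia.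
have hw : 0 < w by rewrite /w; lia.
have ? := le_mul_pos ha hb; have ? := le_mul_pos hb hc.
have ? := le_mul_pos hc ha; have ? := le_mul_pos hw hw.
have : [&& a <= K%:Z, b <= K%:Z, c <= K%:Z & w <= K%:Z] by lia.
by move: ha hb hc hw; rewrite /a /b /c /w; lia.
Qed.

(** With s = Y + T > Z and o = Y - T > -Z the equation reads s (X + Z) + o (X - Z) = 2 m. The lower
    bounds give X + Z^2 <= m, and then s and o are bounded above. *)
Lemma quadrant_box m K X Y Z T : 4 * m <= K%:Z -> quadrant m (X, Y, Z, T) -> (X, Y, Z, T) \in zbox K.
Proof.
move=> hK; rewrite /quadrant /quad mem_zbox => /and5P[/andP[/eqP e _] h1 h2 h3 h4].
have [s hs] : exists s, s = Y + T by exists (Y + T).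
have [o ho] : exists o, o = Y - T by exists (Y - T).
have e2 : s * (X + Z) + o * (X - Z) = 2 * m by rewrite hs ho -e; ring.
have [h5 h6] : - Z + 1 <= o /\ Z + 1 <= s by lia.
have i1 : (- Z + 1) * (X - Z) <= o * (X - Z) by apply: ler_wpM2r; lia.
have i2 : (Z + 1) * (X + Z) <= s * (X + Z) by apply: ler_wpM2r; lia.
have i3 : 0 < Z * Z by apply: mulr_gt0.
have i4 : X <= m by lia.
have i5 : (s - Z) <= (s - Z) * (X + Z) by apply: le_mul_pos; lia.
have i6 : s <= 2 * m + Z by lia.
have i7 : 0 < Z * (X + Z) by apply: mulr_gt0; lia.
have i8 : o <= 2 * m.
  have [ho0|ho0] := lerP o 0; first by lia.
  by have := @le_mul_pos o (X - Z) ho0 ltac:(lia); lia.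
lia.
Qed.

(** If X and Z were both odd, m would have the parity of Y + T, which is then even. This excludes
    the wall X = Z between the two cases of [ltXZ]. *)
Lemma quad_parity m X Y Z T : (m %% 2)%Z == 1 -> quad m (X, Y, Z, T) -> ((X + Z) %% 2)%Z = 1.
Proof.
move=> modd; rewrite /quad => /andP[/eqP e p].
have [x hx] : exists x, X = 2 * x + (X %% 2)%Z by exists (X %/ 2)%Z; lia.
have [y hy] : exists y, Y = 2 * y + (Y %% 2)%Z by exists (Y %/ 2)%Z; lia.
have [z hz] : exists z, Z = 2 * z + (Z %% 2)%Z by exists (Z %/ 2)%Z; lia.
have [t ht] : exists t, T = 2 * t + (T %% 2)%Z by exists (T %/ 2)%Z; lia.
have : exists k, m = 2 * k + (X %% 2)%Z * (Y %% 2)%Z + (Z %% 2)%Z * (T %% 2)%Z.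
  exists (2 * x * y + x * (Y %% 2)%Z + y * (X %% 2)%Z + 2 * z * t + z * (T %% 2)%Z + t * (Z %% 2)%Z).
  by rewrite -e {1}hx {1}hy {1}hz {1}ht; ring.
case=> k hk.
have [] : (X %% 2)%Z = 0 \/ (X %% 2)%Z = 1 by lia.
all: move=> rX; have [] : (Z %% 2)%Z = 0 \/ (Z %% 2)%Z = 1 by lia.
all: move=> rZ; rewrite rX rZ in hk; move: modd; lia.
Qed.

Local Notation wsum K P := (\sum_(v <- zbox K | P v) wt v).

(* No predecessor (X, Y - 2 Z, Z, T + 2 X) in the quadrant. *)
Definition chain_first m (v : int4) : bool :=
  let: (X, Y, Z, T) := v in quadrant m v && (Y - T < 2 * X + Z).

(* No successor (X, Y + 2 Z, Z, T - 2 X) in the quadrant. *)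
Definition chain_last m (v : int4) : bool :=
  let: (X, Y, Z, T) := v in quadrant m v && (Y + T < 2 * X - Z).

(** The weight is constant along a chain, and the step matches the elements that are not last with
    those that are not first. *)
Lemma sum_first_last m K : 4 * m <= K%:Z -> wsum K (chain_first m) = wsum K (chain_last m).
Proof.
move=> hK.
have split (P : pred int4) : wsum K (quadrant m) =
    wsum K (fun v => quadrant m v && P v) + wsum K (fun v => quadrant m v && ~~ P v).
  exact: bigID.
pose up (v : int4) : int4 := let: (X, Y, Z, T) := v in (X, Y + 2 * Z, Z, T - 2 * X).
pose dn (v : int4) : int4 := let: (X, Y, Z, T) := v in (X, Y - 2 * Z, Z, T + 2 * X).
pose isF v := let: (X, Y, Z, T) := v : int4 in Y - T < 2 * X + Z.
pose isL v := let: (X, Y, Z, T) := v : int4 in Y + T < 2 * X - Z.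
have e : wsum K (fun v => quadrant m v && ~~ isF v) = wsum K (fun v => quadrant m v && ~~ isL v).
  apply: (@sum_bij _ _ _ _ _ _ dn up); try exact: zbox_uniq.
  - move=> [[[X Y] Z] T] _ /andP[hQ hF].
    have hQ' : quadrant m (dn (X, Y, Z, T)) && ~~ isL (dn (X, Y, Z, T)).
      move: hQ hF; rewrite /quadrant /quad /isF /isL /=.
      have -> : X * (Y - 2 * Z) + Z * (T + 2 * X) = X * Y + Z * T by ring.
      lia.
    split=> //; last by rewrite /up /dn subrK addrK.
    by case/andP: hQ' => hQ' _; exact: (quadrant_box hK hQ').
  - move=> [[[X Y] Z] T] _ /andP[hQ hL].
    have hQ' : quadrant m (up (X, Y, Z, T)) && ~~ isF (up (X, Y, Z, T)).
      move: hQ hL; rewrite /quadrant /quad /isF /isL /=.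
      have -> : X * (Y + 2 * Z) + Z * (T - 2 * X) = X * Y + Z * T by ring.
      lia.
    split=> //; last by rewrite /up /dn addrK subrK.
    by case/andP: hQ' => hQ' _; exact: (quadrant_box hK hQ').
have := split isF; rewrite (split isL) e => /addIr e2.
have -> : wsum K (chain_first m) = wsum K (fun v => quadrant m v && isF v) by apply: eq_bigl => -[[[X Y] Z] T].
have -> : wsum K (chain_last m) = wsum K (fun v => quadrant m v && isL v) by apply: eq_bigl => -[[[X Y] Z] T].
by rewrite e2.
Qed.

Definition posZ (v : int4) := let: (X, Y, Z, T) := v in 0 < Z.
Definition ltXZ (v : int4) := let: (X, Y, Z, T) := v in X < Z.
Definition inner (v : int4) := let: (X, Y, Z, T) := v in Y - T < Z.

Lemma chamber_sum0 m K : 4 * m <= K%:Z -> (m %% 2)%Z == 1 -> wsum K (chamber m) = 0.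
Proof.
move=> hK modd.
rewrite (bigID posZ) /= [X in X + _](bigID ltXZ) /=.
(* In terms of a, b, c, w the map [f] exchanges a with b and negates w. Chamber points with 0 < X <
   Z thus become the first elements with w < 0, and those with X > Z > 0 are the first elements with
   w > 0. *)
have -> : wsum K (fun v => (chamber m v && posZ v) && ltXZ v) = wsum K (fun v => chain_first m v && inner v).
  pose f (v : int4) : int4 := let: (X, Y, Z, T) := v in (Z, T + X, X, Y - Z).
  have fP X Y Z T : (chamber m (X, Y, Z, T) && posZ (X, Y, Z, T)) && ltXZ (X, Y, Z, T) ->
      chain_first m (f (X, Y, Z, T)) && inner (f (X, Y, Z, T)).
    move=> h; have q : quad m (X, Y, Z, T) by move: h; rewrite /chamber; lia.
    have := quad_parity modd q; move: h; rewrite /chain_first /chamber /quadrant /quad /= /f.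
    have -> : Z * (T + X) + X * (Y - Z) = X * Y + Z * T by ring.
    lia.
  have gP X Y Z T : chain_first m (X, Y, Z, T) && inner (X, Y, Z, T) ->
      (chamber m (f (X, Y, Z, T)) && posZ (f (X, Y, Z, T))) && ltXZ (f (X, Y, Z, T)).
    move=> h; have q : quad m (X, Y, Z, T) by move: h; rewrite /chain_first /quadrant; lia.
    have := quad_parity modd q; move: h; rewrite /chain_first /chamber /quadrant /quad /= /f.
    have -> : Z * (T + X) + X * (Y - Z) = X * Y + Z * T by ring.
    lia.
  apply: (@sum_bij _ _ _ _ _ _ f f); try exact: zbox_uniq.
  - move=> [[[X Y] Z] T] _ h; have h' := fP _ _ _ _ h.
    split=> //; [|by rewrite /f subrK addrK|by rewrite /= mulrC].
    by case/andP: h' => /andP[h' _] _; exact: (quadrant_box hK h').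
  - move=> [[[X Y] Z] T] _ h; have h' := gP _ _ _ _ h.
    split=> //; last by rewrite /f subrK addrK.
    by case/andP: h' => /andP[h' _] _; exact: (chamber_box hK h').
have -> : wsum K (fun v => (chamber m v && posZ v) && ~~ ltXZ v) = wsum K (fun v => chain_first m v && ~~ inner v).
  apply: eq_bigl => -[[[X Y] Z] T].
  apply/idP/idP => h.
  - have q : quad m (X, Y, Z, T) by move: h; rewrite /chamber; lia.
    have := quad_parity modd q; move: h; rewrite /chain_first /chamber /quadrant /=; lia.
  - have q : quad m (X, Y, Z, T) by move: h; rewrite /chain_first /quadrant; lia.
    have := quad_parity modd q; move: h q; rewrite /chain_first /chamber /quadrant /quad /=; lia.
rewrite -(bigID inner) (sum_first_last hK).
pose negZ (v : int4) := let: (X, Y, Z, T) := v in Z < 0.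
rewrite [X in _ + X](bigID negZ) /= [X in _ + (_ + X)]big1 ?addr0; last first.
  move=> [[[X Y] Z] T]; rewrite /posZ /negZ /= => h.
  by have -> : Z = 0 by [lia]; rewrite mulr0.
apply/eqP; rewrite addr_eq0 -sumrN; apply/eqP.
(* This negates the weight and turns the condition a > 0 into the one for a last element. *)
pose f (v : int4) : int4 := let: (X, Y, Z, T) := v in (X, Y, - Z, - T).
apply: (@sum_bij _ _ _ _ _ _ f f); try exact: zbox_uniq.
- move=> [[[X Y] Z] T] _ h.
  have h' : (chamber m (f (X, Y, Z, T)) && ~~ posZ (f (X, Y, Z, T))) && negZ (f (X, Y, Z, T)).
    have q : quad m (X, Y, Z, T) by case/andP: h => /and5P[].
    have := quad_parity modd q; move: h; rewrite /chain_last /chamber /quadrant /quad /negZ /= /f mulrNN; lia.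
  split=> //; [|by rewrite /f !opprK|by rewrite /= mulrN opprK].
  by case/andP: h' => /andP[h' _] _; exact: (chamber_box hK h').
- move=> [[[X Y] Z] T] _ h.
  have h' : chain_last m (f (X, Y, Z, T)).
    have q : quad m (X, Y, Z, T) by case/andP: h => /andP[/and5P[]].
    have := quad_parity modd q; move: h; rewrite /chain_last /chamber /quadrant /quad /negZ /= /f mulrNN; lia.
  split=> //; last by rewrite /f !opprK.
  by case/andP: h' => h' _; exact: (quadrant_box hK h').
Qed.

(** * The recurrences for both forms *)

Definition sol (q : int -> int -> int -> int) (P : int) (v : int4) : bool :=
  let: (a, b, c, w) := v in
  [&& odd_pos a, odd_pos b, odd_pos c, odd_pos w & q a b c + w * w == P].

Definition qprod (a b c : int) := a * b + b * c + c * a.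
Definition qsq (a b c : int) := a * a + b * b + c * c.

Lemma qprod_box P K a b c w : P <= K%:Z -> sol qprod P (a, b, c, w) -> (a, b, c, w) \in zbox K.
Proof.
rewrite mem_zbox /sol /odd_pos /qprod => hP /and5P[/andP[ha _] /andP[hb _] /andP[hc _] /andP[hw _] /eqP e].
have ? := le_mul_pos ha hb; have ? := le_mul_pos hb hc.
have ? := le_mul_pos hc ha; have ? := le_mul_pos hw hw.
lia.
Qed.

Lemma qsq_box P K a b c w : P <= K%:Z -> sol qsq P (a, b, c, w) -> (a, b, c, w) \in zbox K.
Proof.
rewrite mem_zbox /sol /odd_pos /qsq => hP /and5P[/andP[ha _] /andP[hb _] /andP[hc _] /andP[hw _] /eqP e].
have ? := le_mul_pos ha ha; have ? := le_mul_pos hb hb.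
have ? := le_mul_pos hc hc; have ? := le_mul_pos hw hw.
lia.
Qed.

Lemma qprod_sum_XZ m K : 4 * m <= K%:Z -> ((m %% 2)%Z == 1) ->
  \sum_(v <- zbox K | sol qprod (4 * m) v) (let: (a, b, c, w) := v in (a + w) * (b - w)) = 0.
Proof.
move=> hK hm.
transitivity (\sum_(v <- zbox K | chamber m v) 4 * wt v); last first.
  by rewrite -mulr_sumr (chamber_sum0 hK hm) mulr0.
pose f (v : int4) : int4 := let: (a, b, c, w) := v in
  (((a + w) %/ 2)%Z, ((b + c) %/ 2)%Z, ((b - w) %/ 2)%Z, ((c - w) %/ 2)%Z).
pose g (v : int4) : int4 := let: (X, Y, Z, T) := v in
  (2 * X - Y + Z + T, Y + Z - T, Y - Z + T, Y - Z - T).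
apply: (@sum_bij _ _ _ _ _ _ f g); try exact: zbox_uniq.
- move=> [[[a b] c] w] _; rewrite /sol /odd_pos /qprod /f.
  set X := ((a + w) %/ 2)%Z; set Y := ((b + c) %/ 2)%Z.
  set Z := ((b - w) %/ 2)%Z; set T := ((c - w) %/ 2)%Z => /and5P[ha hb hc hw /eqP e].
  have [ea eb ec ew] : [/\ a = 2 * X - Y + Z + T, b = Y + Z - T, c = Y - Z + T & w = Y - Z - T].
    by rewrite /X /Y /Z /T; split; lia.
  clearbody X Y Z T.
  have h : chamber m (X, Y, Z, T).
    have e' : X * Y + Z * T = m.
      by apply: (@mulfI _ 4) => //; rewrite -e ea eb ec ew; ring.
    by rewrite /chamber /quad e' eqxx /=; lia.
  split=> //; [exact: chamber_box hK h | by rewrite /g ea eb ec ew | by rewrite /= ea eb ew; ring].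
- move=> [[[X Y] Z] T] _ h.
  have h' : sol qprod (4 * m) (g (X, Y, Z, T)).
    move: h; rewrite /chamber /quad /sol /qprod /odd_pos /= => /and5P[/andP[/eqP e p] h1 h2 h3 h4].
    by apply/and5P; split; lia.
  split=> //; first exact: qprod_box hK h'.
  by rewrite /f /g; congr (_, _, _, _); lia.
Qed.

(** The weight is the sum of ab - w^2 and its two rotations, and ab - w^2 differs from (a + w)(b -
    w) by (a - b) w, which cancels when a and b are exchanged. *)
Lemma qprod_sum m K : 4 * m <= K%:Z -> ((m %% 2)%Z == 1) ->
  \sum_(v <- zbox K | sol qprod (4 * m) v) (4 * m - 4 * (v.2 * v.2)) = 0.
Proof.
move=> hK hm.
pose S F := \sum_(v <- zbox K | sol qprod (4 * m) v) F v : int.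
have rot (F : int -> int -> int -> int -> int) :
    S (fun v => F v.1.1.1 v.1.1.2 v.1.2 v.2) = S (fun v => F v.1.2 v.1.1.1 v.1.1.2 v.2).
  pose f (v : int4) : int4 := let: (a, b, c, w) := v in (b, c, a, w).
  pose g (v : int4) : int4 := let: (a, b, c, w) := v in (c, a, b, w).
  have hf v : sol qprod (4 * m) v -> sol qprod (4 * m) (f v).
    by case: v => -[[a b] c] w; rewrite /sol /qprod /=; lia.
  have hg v : sol qprod (4 * m) v -> sol qprod (4 * m) (g v).
    by case: v => -[[a b] c] w; rewrite /sol /qprod /=; lia.
  apply: (@sum_bij _ _ _ _ _ _ f g); try exact: zbox_uniq.
  - by move=> [[[a b] c] w] _ h; have h' := hf _ h; split=> //; exact: qprod_box hK h'.
  - by move=> [[[a b] c] w] _ h; have h' := hg _ h; split=> //; exact: qprod_box hK h'.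
have swap (F : int -> int -> int -> int -> int) :
    S (fun v => F v.1.1.1 v.1.1.2 v.1.2 v.2) = S (fun v => F v.1.1.2 v.1.1.1 v.1.2 v.2).
  pose f (v : int4) : int4 := let: (a, b, c, w) := v in (b, a, c, w).
  have hf v : sol qprod (4 * m) v -> sol qprod (4 * m) (f v).
    by case: v => -[[a b] c] w; rewrite /sol /qprod /=; lia.
  apply: (@sum_bij _ _ _ _ _ _ f f); try exact: zbox_uniq.
  - by move=> [[[a b] c] w] _ h; have h' := hf _ h; split=> //; exact: qprod_box hK h'.
  - by move=> [[[a b] c] w] _ h; have h' := hf _ h; split=> //; exact: qprod_box hK h'.
have key : S (fun v => v.1.1.1 * v.1.1.2 - v.2 * v.2) = 0.
  rewrite -[RHS](qprod_sum_XZ hK hm).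
  have -> : \sum_(v <- zbox K | sol qprod (4 * m) v) (let: (a, b, c, w) := v in (a + w) * (b - w)) =
      S (fun v => v.1.1.1 * v.1.1.2 - v.2 * v.2) +
      (S (fun v => v.1.1.2 * v.2) - S (fun v => v.1.1.1 * v.2)).
    rewrite /S -sumrB -big_split /=; apply: eq_bigr => -[[[a b] c] w] _ /=; ring.
  by rewrite (swap (fun a _ _ w => a * w)) subrr addr0.
transitivity (S (fun v => v.1.1.1 * v.1.1.2 - v.2 * v.2) +
   (S (fun v => v.1.1.2 * v.1.2 - v.2 * v.2) + S (fun v => v.1.2 * v.1.1.1 - v.2 * v.2))).
  rewrite /S -!big_split /=; apply: eq_bigr => -[[[a b] c] w].
  rewrite /sol /qprod /= => /and5P[_ _ _ _ /eqP <-]; ring.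
rewrite (rot (fun _ b c w => b * c - w * w)) key add0r add0r.
by rewrite (rot (fun a b c w => c * a - w * w)) (rot (fun a b c w => b * c - w * w)) key.
Qed.

Lemma qsq_sum P K : P <= K%:Z ->
  \sum_(v <- zbox K | sol qsq P v) (P - 4 * (v.2 * v.2)) = 0.
Proof.
move=> hK.
pose S F := \sum_(v <- zbox K | sol qsq P v) F v : int.
have sw (f : int4 -> int4) (F : int4 -> int) :
    (forall v, f (f v) = v) -> (forall v, sol qsq P v -> sol qsq P (f v)) -> S F = S (F \o f).
  move=> ff hf; apply: (@sum_bij _ _ _ _ _ _ f f); try exact: zbox_uniq.
  - move=> v _ h; have := hf _ h; case fv: (f v) => [[[a b] c] w] h'.
    by split=> //=; rewrite -?fv ?ff //; rewrite fv; exact: qsq_box hK h'.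
  - move=> v _ h; have := hf _ h; case fv: (f v) => [[[a b] c] w] h'.
    by split=> //=; rewrite -?fv ?ff //; rewrite fv; exact: qsq_box hK h'.
pose W := S (fun v => v.2 * v.2).
have ea : S (fun v => v.1.1.1 * v.1.1.1) = W.
  rewrite (sw (fun v => let: (a, b, c, w) := v in (w, b, c, a))).
  - by apply: eq_bigr => -[[[a b] c] w].
  - by move=> [[[a b] c] w].
  - by move=> [[[a b] c] w]; rewrite /sol /qsq; lia.
have eb : S (fun v => v.1.1.2 * v.1.1.2) = W.
  rewrite (sw (fun v => let: (a, b, c, w) := v in (a, w, c, b))).
  - by apply: eq_bigr => -[[[a b] c] w].
  - by move=> [[[a b] c] w].
  - by move=> [[[a b] c] w]; rewrite /sol /qsq; lia.
have ec : S (fun v => v.1.2 * v.1.2) = W.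
  rewrite (sw (fun v => let: (a, b, c, w) := v in (a, b, w, c))).
  - by apply: eq_bigr => -[[[a b] c] w].
  - by move=> [[[a b] c] w].
  - by move=> [[[a b] c] w]; rewrite /sol /qsq; lia.
transitivity (S (fun v => v.1.1.1 * v.1.1.1) + S (fun v => v.1.1.2 * v.1.1.2) +
    S (fun v => v.1.2 * v.1.2) - (W + W + W)); last by rewrite ea eb ec subrr.
rewrite /W /S -!big_split /= -sumrB; apply: eq_bigr => -[[[a b] c] w].
rewrite /sol /qsq /= => /and5P[_ _ _ _ /eqP <-]; ring.
Qed.

(** * Comparison of the two counts *)

Definition zbox3 (K : nat) : seq (int * int * int) :=
  [seq (q, c) | q <- [seq (a, b) | a <- zrange K, b <- zrange K], c <- zrange K].

Definition sol3 (q : int -> int -> int -> int) (M : int) (v : int * int * int) : bool :=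
  let: (a, b, c) := v in [&& odd_pos a, odd_pos b, odd_pos c & q a b c == M].

Lemma sol3P q M a b c : sol3 q M (a, b, c) -> [/\ 0 < a, 0 < b, 0 < c & q a b c = M].
Proof. by move=> /and4P[/andP[-> _] /andP[-> _] /andP[-> _] /eqP]. Qed.

Definition nsol q K M : int := \sum_(v <- zbox3 K | sol3 q M v) 1.

Lemma sum_nsol q P K :
  \sum_(v <- zbox K | sol q P v) (P - 4 * (v.2 * v.2)) =
  \sum_(w <- zrange K | odd_pos w) (P - 4 * (w * w)) * nsol q K (P - w * w).
Proof.
rewrite big_mkcond /zbox -/(zbox3 K) big_allpairs exchange_big [RHS]big_mkcond.
apply: eq_bigr => w _; rewrite /nsol mulr_sumr; case hw: (odd_pos w); last first.
  by apply: big1 => -[[a b] c] _; rewrite /sol hw !andbF.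
rewrite [RHS]big_mkcond; apply: eq_bigr => -[[a b] c] _.
by rewrite /sol /sol3 hw mulr1 (eq_sym (q a b c)) subr_eq eq_sym.
Qed.

(** At m = 2 n + 1 the term w = 1 is 8 n D(8 n + 3), while odd w >= 3 lead to smaller arguments,
    again 3 mod 8. For n = 0 the coefficient vanishes, hence the separate hypothesis on D 3. *)
Lemma nsol_unique (K : nat) (D : int -> int) :
  D 3 = 0 -> (forall M, M <= 0 -> D M = 0) ->
  (forall m, 4 * m <= K%:Z -> (m %% 2)%Z == 1 ->
     \sum_(w <- zrange K | odd_pos w) (4 * m - 4 * (w * w)) * D (4 * m - w * w) = 0) ->
  forall n : nat, (8 * n + 4 <= K)%N -> D (8 * n%:Z + 3) = 0.
Proof.
move=> D3 D0 hD; elim/ltn_ind => n IH hn.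
case: (posnP n) => [->|n0]; first by rewrite mulr0 add0r.
have := hD (2 * n%:Z + 1) ltac:(lia) ltac:(lia).
have h1 : 1 \in [seq w <- zrange K | odd_pos w] by rewrite mem_filter mem_zrange /odd_pos; lia.
rewrite -big_filter (bigD1_seq 1 h1) ?filter_uniq ?zrange_uniq //.
rewrite big1_seq.
  rewrite /= addr0 => /eqP; rewrite mulf_eq0 => /orP[|/eqP <-]; first by lia.
  by congr D; lia.
move=> w; rewrite mem_filter => /andP[w2 /andP[/andP[w0 /eqP w1] _]].
have [k hk] : exists k : nat, w = 2 * k%:Z + 3 by exists (absz ((w - 3) %/ 2)%Z); lia.
have [hle|hgt] := lerP (4 * (2 * n%:Z + 1) - w * w) 0; first by rewrite D0 ?mulr0.
have [j hj] : exists j : nat, (k * k + 3 * k = 2 * j)%N.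
  exists ((k * k + 3 * k) %/ 2)%N.
  have : ~~ odd (k * k + 3 * k) by rewrite oddD !oddM; case: (odd k).
  lia.
have e : w * w = 8 * j%:Z + 9.
  have -> : w * w = 4 * (k * k + 3 * k)%N%:Z + 9 by rewrite hk; lia.
  by rewrite hj; lia.
have -> : 4 * (2 * n%:Z + 1) - w * w = 8 * (n - j - 1)%N%:Z + 3 by lia.
by rewrite IH ?mulr0 //; lia.
Qed.

Lemma three_odd_squares (n : nat) : exists a b c : int,
  [/\ odd_pos a, odd_pos b, odd_pos c & a * a + b * b + c * c = 8 * n%:Z + 3].
Proof.
(* The largest value 4 m at which the recurrence is applied. *)
set K := (8 * n + 4)%N.
have hu M : M <= 0 -> forall v, ~~ sol3 qprod M v /\ ~~ sol3 qsq M v.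
  move=> hM [[a b] c]; split; apply/negP => /sol3P[ha hb hc]; rewrite /qprod /qsq => e.
    by have := mulr_gt0 ha hb; have := mulr_gt0 hb hc; have := mulr_gt0 hc ha; lia.
  by have := mulr_gt0 ha ha; have := mulr_gt0 hb hb; have := mulr_gt0 hc hc; lia.
have eqD : nsol qprod K (8 * n%:Z + 3) - nsol qsq K (8 * n%:Z + 3) = 0.
  apply: (@nsol_unique K (fun M => nsol qprod K M - nsol qsq K M)) => //.
  - apply/eqP; rewrite subr_eq0; apply/eqP; apply: eq_bigl => -[[a b] c].
    apply/idP/idP => /sol3P[ha hb hc]; rewrite /qprod /qsq => e.
      have ? := le_mul_pos ha hb; have ? := le_mul_pos hb hc; have ? := le_mul_pos hc ha.
      by have [-> -> ->] : [/\ a = 1, b = 1 & c = 1] by split; lia.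
    have ? := le_mul_pos ha ha; have ? := le_mul_pos hb hb; have ? := le_mul_pos hc hc.
    by have [-> -> ->] : [/\ a = 1, b = 1 & c = 1] by split; lia.
  - move=> M hM; rewrite /nsol big1 ?big1 ?subrr // => v; case: (hu _ hM v) => h1 h2.
      by rewrite (negbTE h2).
    by rewrite (negbTE h1).
  - move=> m hm om.
    under eq_bigr do rewrite mulrBr.
    by rewrite sumrB -!sum_nsol qprod_sum // qsq_sum // subrr.
have : has (sol3 qsq (8 * n%:Z + 3)) (zbox3 K).
  apply/negPn/negP => hn.
  have e0 : nsol qsq K (8 * n%:Z + 3) = 0.
    rewrite /nsol big_seq_cond big1 // => v /andP[hv hs].
    by move/hasPn: hn => /(_ v hv); rewrite hs.
  move/eqP: eqD; rewrite e0 subr0 /nsol psumr_eq0 // => /allP /(_ (1, 1, 4 * n%:Z + 1)).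
  rewrite !mem_pairs !mem_zrange implybF => h.
  suff /h : [&& (- K%:Z <= 1 <= K%:Z) && (- K%:Z <= 1 <= K%:Z)
             & - K%:Z <= 4 * n%:Z + 1 <= K%:Z].
    by rewrite /sol3 /odd_pos /qprod; lia.
  lia.
case/hasP => -[[a b] c] _; rewrite /sol3 => /and4P[ha hb hc /eqP e].
by exists a, b, c.
Qed.

(** Stated over nat to pass from [int] to [Z], where the rest of the argument runs. *)
Lemma three_odd_squares_nat (n : nat) : exists a b c : nat,
  ((2 * a + 1) * (2 * a + 1) + (2 * b + 1) * (2 * b + 1) + (2 * c + 1) * (2 * c + 1) = 8 * n + 3)%N.
Proof.
have odd_posP x : odd_pos x -> exists k : nat, x = (2 * k + 1)%N.
  by move=> /andP[x0 /eqP x1]; exists (absz (x %/ 2)%Z); lia.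
have [x [y [z [/odd_posP[a ->] /odd_posP[b ->] /odd_posP[c ->] e]]]] := three_odd_squares n.
by exists a, b, c; lia.
Qed.

End ThreeOddSquares.

Ltac Zify.zify_post_hook ::= Z.to_euclidean_division_equations.

Section Pentagonal.
Local Open Scope Z_scope.

(** * Large numbers *)

(** The third entry keeps its sign: [compat7] ignores it, and it is chosen at the end to make B + C
    divisible by 4. *)
Definition signed_perms (a b c : Z) : list (Z * Z * Z) :=
  List.flat_map (fun t => let '(a, b, c) := t in [:: (a, b, c); (- a, b, c); (a, - b, c); (- a, - b, c)])
    [:: (a, b, c); (b, a, c); (a, c, b); (c, a, b); (b, c, a); (c, b, a)].

Definition compat7 (h : Z) (t : Z * Z * Z) : bool :=
  let '(a, b, _) := t in (b - h - 3 * a) mod 7 =? 0.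

(* A residue of h mod 7 for which compat7 can always be met, given N mod 7. *)
Definition res7 (N : Z) : Z := nth 0 [:: 1; 1; 3; 1; 2; 2; 1] (Z.to_nat N).

Definition digits7 := [:: 0; 1; 2; 3; 4; 5; 6].

Lemma all_digits7 (P : Z -> bool) r : List.forallb P digits7 = true -> 0 <= r < 7 -> P r = true.
Proof.
move=> /List.forallb_forall h hr; apply: h.
by have : r = 0 \/ r = 1 \/ r = 2 \/ r = 3 \/ r = 4 \/ r = 5 \/ r = 6 by [lia]; rewrite /=; intuition.
Qed.

Lemma compat7_check :
  List.forallb (fun N => List.forallb (fun a => List.forallb (fun b => List.forallb (fun c =>
    implb ((a * a + b * b + c * c + 2 * (res7 N * res7 N) - N) mod 7 =? 0)
          (List.existsb (compat7 (res7 N)) (signed_perms a b c)))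
    digits7) digits7) digits7) digits7 = true.
Proof. by vm_compute. Qed.

Lemma exists_compat7 N h A B C :
  h mod 7 = res7 (N mod 7) -> A * A + B * B + C * C + 2 * (h * h) = N ->
  exists t, List.In t (signed_perms A B C) /\ compat7 h t = true.
Proof.
move=> hh e; apply/List.existsb_exists.
have hr x : 0 <= x mod 7 < 7 by exact: Z.mod_pos_bound.
have := all_digits7 (all_digits7 (all_digits7 (all_digits7 compat7_check (hr N)) (hr A)) (hr B)) (hr C).
(* [compat7] sees only residues mod 7, so each test on residues equals the test on A, B, C, h. *)
rewrite -hh => /implyP h7; rewrite -[RHS]h7.
  cbn -[Z.mul Z.sub Z.opp Z.modulo Z.eqb].
  by repeat (congr orb); congr Z.eqb; clear; lia.
apply/Z.eqb_eq.
have [a ->] : exists a, A mod 7 = A - 7 * a by exists (A / 7); lia.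
have [b ->] : exists b, B mod 7 = B - 7 * b by exists (B / 7); lia.
have [c ->] : exists c, C mod 7 = C - 7 * c by exists (C / 7); lia.
have [k ->] : exists k, h mod 7 = h - 7 * k by exists (h / 7); lia.
have [n ->] : exists n, N mod 7 = N - 7 * n by exists (N / 7); lia.
apply: Znumtheory.Zdivide_mod.
exists (- 2 * a * A + 7 * a * a - 2 * b * B + 7 * b * b - 2 * c * C + 7 * c * c
        - 4 * k * h + 14 * k * k + n).
by rewrite -e; ring.
Qed.

Lemma signed_perms_spec A B C a b c : List.In (a, b, c) (signed_perms A B C) ->
  a * a + b * b + c * c = A * A + B * B + C * C /\
  (A mod 6 = 3 -> B mod 6 = 3 -> C mod 6 = 3 -> [/\ a mod 6 = 3, b mod 6 = 3 & c mod 6 = 3]).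
Proof.
cbn -[Z.mul Z.add Z.opp Z.modulo] => h.
repeat (case: h => [[<- <- <-]|h]; first by split; [ring | move=> *; split; lia]).
by [].
Qed.

Definition repr5 (n : Z) : Prop := exists x y z w,
  [/\ 0 <= x, 0 <= y, 0 <= z, 0 <= w &
   2 * n = x * (3 * x - 1) + y * (3 * y - 1) + z * (3 * z - 1) + 2 * (w * (3 * w - 1))].

Lemma rotate7 n h A B C :
  24 * n + 5 = 2 * (h * h) + A * A + B * B + C * C ->
  h mod 6 = 5 -> A mod 6 = 3 -> B mod 6 = 3 -> C mod 6 = 3 ->
  (B - h - 3 * A) mod 7 = 0 -> (B + C) mod 4 = 0 ->
  0 < h -> 97 * (24 * n + 5) < 196 * (h * h) -> repr5 n.
Proof.
move=> e h6 A6 B6 C6 c7 c4 h0 hN.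
have [k ek] : exists k, B = h + 3 * A + 7 * k by exists ((B - h - 3 * A) / 7); lia.
have [j ej] : exists j, C = 4 * j - B by exists ((B + C) / 4); lia.
(* The image under the isometry: once k and j are substituted, the coefficients of h are 1, 4/7,
   1/7, 4/7. *)
pose X := h + 2 * j; pose Y := - A - 4 * k.
pose Z := - h - 4 * A - 8 * k + 2 * j; pose W := h + A + 3 * k - 2 * j.
have eN : X * X + Y * Y + Z * Z + 2 * (W * W) = 24 * n + 5.
  by rewrite e /X /Y /Z /W ej ek; ring.
have eh : 7 * X + 4 * Y + Z + 8 * W = 14 * h by rewrite /X /Y /Z /W; ring.
have [X6 Y6 Z6 W6] : [/\ X mod 6 = 5, Y mod 6 = 5, Z mod 6 = 5 & W mod 6 = 5].
  by rewrite /X /Y /Z /W; split; lia.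
move: (X) (Y) (Z) (W) eN eh X6 Y6 Z6 W6 => {}X {}Y {}Z {}W eN eh X6 Y6 Z6 W6.
have sq u : 14 * h <= u -> u * u <= 97 * (24 * n + 5) -> False.
  move=> hu; have := Z.mul_le_mono_nonneg (14 * h) u (14 * h) u ltac:(lia) hu ltac:(lia) hu.
  by lia.
(* Dropping a nonpositive term of 7X + 4Y + Z + 8W leaves at least 14 h. By Cauchy-Schwarz the
   square of the rest is at most N times 49 + 16 + 1 + 32 = 98 less one of these summands, so at
   most 97 N. *)
have [X0 Y0 Z0 W0] : [/\ 0 < X, 0 < Y, 0 < Z & 0 < W].
  have hX := Z.square_nonneg X; have hY := Z.square_nonneg Y.
  have hZ := Z.square_nonneg Z; have hW := Z.square_nonneg W.
  have hXY := Z.square_nonneg (7 * Y - 4 * X); have hXZ := Z.square_nonneg (7 * Z - X).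
  have hXW := Z.square_nonneg (7 * W - 4 * X); have hYZ := Z.square_nonneg (4 * Z - Y).
  have hYW := Z.square_nonneg (W - Y); have hZW := Z.square_nonneg (W - 4 * Z).
  split; apply/Z.nle_gt => le0.
  - by apply: (sq (4 * Y + Z + 8 * W)); lia.
  - by apply: (sq (7 * X + Z + 8 * W)); lia.
  - by apply: (sq (7 * X + 4 * Y + 8 * W)); lia.
  - by apply: (sq (7 * X + 4 * Y + Z)); lia.
have [x ex] : exists x, X = 6 * x - 1 by exists ((X + 1) / 6); lia.
have [y ey] : exists y, Y = 6 * y - 1 by exists ((Y + 1) / 6); lia.
have [z ez] : exists z, Z = 6 * z - 1 by exists ((Z + 1) / 6); lia.
have [w ew] : exists w, W = 6 * w - 1 by exists ((W + 1) / 6); lia.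
exists x, y, z, w; split; [lia | lia | lia | lia |].
by move: eN; rewrite ex ey ez ew; clear; lia.
Qed.

(** Here 126 = lcm(6, 7, 9), and 24 n + 5 mod 9 and mod 7 depends only on n mod 21. *)
Lemma exists_residue n : exists c, [/\ 0 <= c < 126, c mod 6 = 5,
  (24 * n + 5 - 2 * (c * c)) mod 9 = 0 & c mod 7 = res7 ((24 * n + 5) mod 7)].
Proof.
have [r [q [hr ->]]] : exists r q, 0 <= r < 21 /\ n = 21 * q + r.
  by exists (n mod 21), (n / 21); lia.
have -> : (24 * (21 * q + r) + 5) mod 7 = (24 * r + 5) mod 7 by lia.
suff [c [h1 h2 h3 h4]] : exists c, [/\ 0 <= c < 126, c mod 6 = 5,
    (24 * r + 5 - 2 * (c * c)) mod 9 = 0 & c mod 7 = res7 ((24 * r + 5) mod 7)].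
  by exists c; split=> //; lia.
have : List.forallb (fun r => List.existsb (fun c => [&& c mod 6 =? 5,
    (24 * r + 5 - 2 * (c * c)) mod 9 =? 0 & c mod 7 =? res7 ((24 * r + 5) mod 7)])
    (List.map Z.of_nat (List.seq 0 126))) (List.map Z.of_nat (List.seq 0 21)) = true by vm_compute.
have mem k x : List.In x (List.map Z.of_nat (List.seq 0 k)) <-> 0 <= x < Z.of_nat k.
  rewrite List.in_map_iff; split=> [[i [<- /List.in_seq]]|hx]; first by lia.
  by exists (Z.to_nat x); rewrite List.in_seq; lia.
move=> /List.forallb_forall H; have hin : List.In r (List.map Z.of_nat (List.seq 0 21)).
  by apply/mem; lia.
move: (H r hin) => /List.existsb_exists [c [/mem hc /and3P[/Z.eqb_eq h1 /Z.eqb_eq h2 /Z.eqb_eq h3]]].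
by exists c; split=> //; lia.
Qed.

Lemma three_odd_squares_Z M : 0 <= M -> M mod 8 = 3 -> exists a b c,
  [/\ a mod 2 = 1, b mod 2 = 1, c mod 2 = 1 & a * a + b * b + c * c = M].
Proof.
move=> M0 M8; have [a [b [c e]]] := three_odd_squares_nat (Z.to_nat (M / 8)).
by exists (2 * Z.of_nat a + 1), (2 * Z.of_nat b + 1), (2 * Z.of_nat c + 1); split; lia.
Qed.

Lemma repr5_large n : 2 * (24633 * 24633) <= 24 * n + 5 -> repr5 n.
Proof.
move=> hn; have [c [c126 c6 c9 c7]] := exists_residue n.
have [h [h0 hc h1 h2]] : exists h, [/\ 0 <= h, (h - c) mod 126 = 0, 2 * (h * h) <= 24 * n + 5 &
    24 * n + 5 < 2 * ((h + 126) * (h + 126))].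
  have [s1 s2] := Z.sqrt_spec ((24 * n + 5) / 2) ltac:(lia).
  have s0 : 24633 <= Z.sqrt ((24 * n + 5) / 2).
    by rewrite -[X in X <= _](Z.sqrt_square 24633) //; apply: Z.sqrt_le_mono; lia.
  move: (Z.sqrt _) s0 s1 s2 => s s0 s1 s2.
  have [r [r1 r2]] : exists r, 0 <= r < 126 /\ (s - r - c) mod 126 = 0.
    by exists ((s - c) mod 126); lia.
  exists (s - r); split=> //; first by lia.
  - by have := @Z.mul_le_mono_nonneg (s - r) s (s - r) s; lia.
  - by have := @Z.mul_le_mono_nonneg (s + 1) (s - r + 126) (s + 1) (s - r + 126); lia.
have h3 : 24508 <= h.
  apply/Z.nlt_ge => h3.
  by have := @Z.mul_le_mono_nonneg (h + 126) 24633 (h + 126) 24633; lia.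
have [q eq] : exists q, h = 126 * q + c by exists ((h - c) / 126); lia.
have [M eM] : exists M, 24 * n + 5 - 2 * (h * h) = 9 * M.
  exists ((24 * n + 5 - 2 * (h * h)) / 9); rewrite eq; lia.
have h8 : (h * h) mod 8 = 1.
  have [p ->] : exists p, h = 2 * p + 1 by exists (h / 2); lia.
  have [s es] : exists s, p * (p + 1) = 2 * s.
    have [t [->|->]] : exists t, p = 2 * t \/ p = 2 * t + 1 by exists (p / 2); lia.
      by exists (t * (2 * t + 1)); ring.
    by exists ((2 * t + 1) * (t + 1)); ring.
  by lia.
have [a [b [d [a2 b2 d2 e]]]] := @three_odd_squares_Z M ltac:(lia) ltac:(lia).
have e' : 3 * a * (3 * a) + 3 * b * (3 * b) + 3 * d * (3 * d) + 2 * (h * h) = 24 * n + 5 by lia.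
have hh : h mod 7 = res7 ((24 * n + 5) mod 7) by rewrite -c7 eq; lia.
have [[[A B] C] [ht hcomp]] := exists_compat7 hh e'.
have [eABC h6] := signed_perms_spec ht.
have [A6 B6 C6] : [/\ A mod 6 = 3, B mod 6 = 3 & C mod 6 = 3] by apply: h6; lia.
have c7' : (B - h - 3 * A) mod 7 = 0 by move/Z.eqb_eq: hcomp.
(* As N < 2 (h + 126)^2, it suffices that 97 (h + 126)^2 <= 98 h^2, that is h (h - 24444) >= 97 *
   126^2 = 1539972; and 24508 * 64 = 1568512. *)
have hN : 97 * (24 * n + 5) < 196 * (h * h).
  by have := @Z.mul_le_mono_nonneg 24508 h 64 (h - 24444); lia.
have [c4|c4] : (B + C) mod 4 = 0 \/ (B + - C) mod 4 = 0 by lia.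
- by apply: (@rotate7 n h A B C) => //; lia.
- by apply: (@rotate7 n h A B (- C)) => //; lia.
Qed.

(** * Small numbers *)

Definition pent (x : Z) : Z := x * (3 * x - 1) / 2.

Lemma pentE x : 2 * pent x = x * (3 * x - 1).
Proof.
have [t [->|->]] : exists t, x = 2 * t \/ x = 2 * t + 1 by exists (x / 2); lia.
- have -> : pent (2 * t) = t * (3 * (2 * t) - 1) by symmetry; apply: Z.div_unique_exact => //; ring.
  ring.
- have -> : pent (2 * t + 1) = (2 * t + 1) * (3 * t + 1) by symmetry; apply: Z.div_unique_exact => //; ring.
  ring.
Qed.

Fixpoint zints (k : nat) (a : Z) : list Z :=
  if k is k'.+1 then a :: zints k' (a + 1) else [::].

Lemma zintsP k a x : List.In x (zints k a) <-> a <= x < a + Z.of_nat k.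
Proof. by elim: k a => [|k IH] a /=; rewrite ?IH; lia. Qed.

(* Unlike [List.existsb], [List.find] does not evaluate the tail after a success. *)
Definition search (f : Z -> bool) (l : list Z) : bool := isSome (List.find f l).

Lemma searchP f l : search f l -> exists2 x, List.In x l & f x.
Proof. by rewrite /search; case e: (List.find f l) => [x|] // _; have [] := List.find_some _ _ e; exists x. Qed.

(** Keys are shifted by 1 to be positive. The bound is ample, as pent 121 = 21901 exceeds 21217.
    Negative lookups also land on key 1, where the test in [check3] rejects them. *)
Definition table : PositiveMap.t (Z * Z) :=
  List.fold_left (fun t y =>
    List.fold_left (fun t z =>
      PositiveMap.add (Z.to_pos (pent y + pent z + 1)) (y, z) t) (zints 121 0) t)
    (zints 121 0) (PositiveMap.empty (Z * Z)).

(* The equation is checked anew, so nothing has to be known about the table. *)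
Definition check3 (t : PositiveMap.t (Z * Z)) (R : Z) : bool :=
  search (fun w =>
    if PositiveMap.find (Z.to_pos (R - 2 * pent w + 1)) t is Some (y, z)
    then [&& 0 <=? y, 0 <=? z & R =? pent y + pent z + 2 * pent w] else false) (zints 90 0).

Definition check5 (t : PositiveMap.t (Z * Z)) (n : Z) : bool :=
  search (fun x => check3 t (n - pent x)) (zints 60 0).

Lemma check3P t R x : check3 t R -> 0 <= x -> repr5 (pent x + R).
Proof.
move=> /searchP[w /zintsP hw]; case: PositiveMap.find => [[y z]|] //.
move=> /and3P[/Z.leb_le hy /Z.leb_le hz /Z.eqb_eq e] hx.
exists x, y, z, w; split; [lia | lia | lia | lia |].
by rewrite -!pentE e; ring.
Qed.

(** The length 17423 = 21217 - 3794 exceeds the gap 3 s + 1 after [pent s] for all s <= 5807. *)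
Lemma check3_table : List.forallb (check3 table) (zints (Z.to_nat 17423) 3794).
Proof. by vm_compute. Qed.

Lemma check5_table : List.forallb (check5 table) (zints 3794 0).
Proof. by vm_compute. Qed.

Lemma repr5_small n : 0 <= n -> 24 * n + 5 < 2 * (24633 * 24633) -> repr5 n.
Proof.
move=> n0 hn; have [lt|ge] := Z.lt_ge_cases n 3794.
  have /List.forallb_forall/(_ n) H := check5_table.
  have /searchP[x /zintsP hx hc] : check5 table n by apply: H; apply/zintsP; lia.
  have -> : n = pent x + (n - pent x) by ring.
  by apply: check3P hc _; lia.
have [s [s0 s1 s2]] : exists s, [/\ 0 <= s, pent s <= n - 3794 & n - 3794 < pent (s + 1)].
  (* Since 24 pent s + 1 = (6 s - 1)^2, this is the largest s with pent s <= m. *)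
  set m := n - 3794; pose s := (Z.sqrt (24 * m + 1) + 1) / 6.
  have [q1 q2] := Z.sqrt_spec (24 * m + 1) ltac:(lia).
  have q0 := Z.sqrt_nonneg (24 * m + 1).
  move: (Z.sqrt _) @s q0 q1 q2 => r s q0 q1 q2.
  have [s1 s2] : 6 * s - 1 <= r /\ r < 6 * s + 5 by lia.
  have s0 : 0 <= s by lia.
  have := pentE s; have := pentE (s + 1) => p1 p2; exists s; split=> //.
  (* For s = 0 the bound 6 s - 1 is negative and cannot be squared. *)
  - have [->|sp] : s = 0 \/ 0 < s by lia.
      by rewrite /pent; lia.
    by have := @Z.mul_le_mono_nonneg (6 * s - 1) r (6 * s - 1) r; lia.
  - by have := @Z.mul_le_mono_nonneg (r + 1) (6 * s + 5) (r + 1) (6 * s + 5); lia.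
have p1 := pentE s; have p2 := pentE (s + 1).
have s3 : s <= 5807.
  apply/Z.nlt_ge => s3.
  by have := @Z.mul_le_mono_nonneg 5808 s 17423 (3 * s - 1); lia.
have -> : n = pent s + (n - pent s) by ring.
apply: (@check3P table) => //.
have /List.forallb_forall/(_ (n - pent s)) H := check3_table.
by apply: H; apply/zintsP; lia.
Qed.

(** * Return to natural numbers *)

Lemma p5E (k : nat) : 2 * Z.of_nat (p5 k) = Z.of_nat k * (3 * Z.of_nat k - 1).
Proof.
have ev : ~~ odd (k * (3 * k - 1)).
  by case: k => [|k] //; rewrite oddM oddB ?oddM; [case: (odd _) | lia].
have -> : 2 * Z.of_nat (p5 k) = Z.of_nat (k * (3 * k - 1)).
  by rewrite /p5 divn2 -[in RHS](even_halfK ev) -muln2; lia.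
(* The subtraction truncates only at k = 0, where the factor k is 0. *)
by case: k {ev} => [|k] //; lia.
Qed.

End Pentagonal.

Theorem theorem1p1 : forall n : nat,
  exists x y z w : nat, n = p5 x + p5 y + p5 z + 2 * p5 w.
Proof.
move=> n.
have [x [y [z [w [x0 y0 z0 w0 e]]]]] : repr5 (Z.of_nat n).
  have [lt|ge] := Z.lt_ge_cases (Z.add (Z.mul 24 (Z.of_nat n)) 5) (Z.mul 2 (Z.mul 24633 24633)).
    by apply: repr5_small => //; lia.
  by apply: repr5_large; lia.
exists (Z.to_nat x), (Z.to_nat y), (Z.to_nat z), (Z.to_nat w).
have := p5E (Z.to_nat x); have := p5E (Z.to_nat y).
have := p5E (Z.to_nat z); have := p5E (Z.to_nat w).
rewrite !Z2Nat.id //; lia.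
Qed.
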